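(* Let $\lambda>0$ and $0\le\alpha<1$, and let $X_1,\dots,X_n$ be i.i.d. random variables with the generalized Poisson distribution $$\Pr\{X=x\}=\frac{\lambda(\lambda+x\alpha)^{x-1}e^{-\lambda-x\alpha}}{x!},\qquad x=0,1,2,\dots,$$ and $\overline{X}_n=\frac1n\sum_{i=1}^nX_i$. Then $$\Pr\{\overline{X}_n\le z\}\le\frac{\lambda}{(1-\alpha)(\lambda+z\alpha)}\Big[\Big(\frac\lambda z+\alpha\Big)^z\frac{e^{(1-\alpha)z}}{e^\lambda}\Big]^n\quad\text{if }0<z\le\frac{\lambda}{1-\alpha},$$ $$\Pr\{\overline{X}_n\ge z\}\le\frac{\lambda}{(1-\alpha)(\lambda+z\alpha)}\Big[\Big(\frac\lambda z+\alpha\Big)^z\frac{e^{(1-\alpha)z}}{e^\lambda}\Big]^n\quad\text{if }z\ge\frac{\lambda}{1-\alpha}.$$ Moreover, with $\nu=\frac12\big[(1-\alpha)z+\sqrt{(1-\alpha)^2z^2+4z\alpha/n}\big]$, $$\Pr\{\overline{X}_n\le z\}\le\frac{\lambda(\nu+z\alpha)}{\nu(\lambda+z\alpha)}\Big[\Big(\frac{\lambda+z\alpha}{\nu+z\alpha}\Big)^z\frac{e^\nu}{e^\lambda}\Big]^n\quad\text{if }0<z\le\frac{\lambda}{1-\alpha+\frac{\alpha}{n\lambda}},$$ $$\Pr\{\overline{X}_n\ge z\}\le\frac{\lambda(\nu+z\alpha)}{\nu(\lambda+z\alpha)}\Big[\Big(\frac{\lambda+z\alpha}{\nu+z\alpha}\Big)^z\frac{e^\nu}{e^\lambda}\Big]^n\quad\text{if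 }z\ge\frac{\lambda}{1-\alpha+\frac{\alpha}{n\lambda}}.$$ Furthermore, if $\alpha=0$, then with $\varDelta=\min\big\{\frac12,\frac{\mathscr{C}}{\sqrt n}(3+\frac1z)^{3/4}\big\}$, where $\mathscr{C}$ is the Berry–Esseen constant, $$\Pr\{\overline{X}_n\ge z\}\le\Big(\frac12+\varDelta\Big)\Big(\frac{\lambda^ze^z}{z^ze^\lambda}\Big)^n\ \text{ for }z\ge\lambda,\qquad \Pr\{\overline{X}_n\le z\}\le\Big(\frac12+\varDelta\Big)\Big(\frac{\lambda^ze^z}{z^ze^\lambda}\Big)^n\ \text{ for }0<z\le\lambda.$$
   Context: The Berry–Esseen constant $\mathscr{C}$ is a positive absolute constant such that for every random variable $Y$ with $\mathbb{E}[Y]=0$, $\mathbb{E}[Y^2]>0$, $\mathbb{E}[|Y|^3]<\infty$, every $n$ and every $y\in\mathbb{R}$, $|F_n(y)-\Phi(y)|\le\frac{\mathscr{C}}{\sqrt n}\frac{\mathbb{E}[|Y|^3]}{\mathbb{E}^{3/2}[Y^2]}$, where $F_n$ is the cdf of $\sum_{i=1}^nY_i/\sqrt{n\mathbb{E}[Y^2]}$ for i.i.d. copies $Y_i$ of $Y$ and $\Phi$ is the standard normal cdf. *)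

(* Defs.v *)
From HB Require Import structures.
From mathcomp Require Import all_boot all_order all_algebra.
From mathcomp Require Import all_classical all_reals all_analysis.
Set Implicit Arguments. Unset Strict Implicit. Unset Printing Implicit Defensive.
Import Order.TTheory GRing.Theory Num.Theory.
Import numFieldNormedType.Exports.
Local Open Scope classical_set_scope.
Local Open Scope ring_scope.

(* Generalized Poisson probability mass function:
   P{X = x} = lam (lam + x a)^(x-1) e^(-lam - x a) / x!   (x = 0,1,2,...)
   (the exponent x-1 is an integer exponent, = -1 for x = 0). *)
Definition gen_poisson_pmf {R : realType} (lam a : R) (x : nat) : R :=
  lam * (lam + x%:R * a) ^ (x%:Z - 1) * expR (- lam - x%:R * a) / (x`!)%:R.

(* Mutual independence of a finite family of real random variables:
   product rule for every family of Borel sets (taking B i = setT recovers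
   every subfamily). *)
Definition mutually_independent {R : realType} d (T : measurableType d)
    (P : probability T R) (n : nat) (X : 'I_n -> {RV P >-> R}) : Prop :=
  forall B : 'I_n -> set R, (forall i, measurable (B i)) ->
    P [set t | forall i, B i (X i t)] =
    (\big[*%E/1%E]_(i < n) P (X i @^-1` B i))%E.

Definition identically_distributed {R : realType} d (T : measurableType d)
    (P : probability T R) (n : nat) (X : 'I_n -> {RV P >-> R}) : Prop :=
  forall i j (B : set R), measurable B -> P (X i @^-1` B) = P (X j @^-1` B).

Definition Phi {R : realType} (y : R) : R := fine (normal_prob 0 1 `]-oo, y]).

Definition berry_esseen_constant {R : realType} (C : R) : Prop :=
  0 < C /\
  forall d (T : measurableType d) (P : probability T R) (m : nat)
         (Y : 'I_m.+1 -> {RV P >-> R}),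
    mutually_independent Y -> identically_distributed Y ->
    ('E_P[Y ord0] = 0)%E ->
    (0 < 'E_P[(fun t => Y ord0 t ^+ 2)%R])%E ->
    ('E_P[(fun t => `|Y ord0 t| ^+ 3)%R] < +oo)%E ->
    forall y : R,
      `| fine (P [set t | (\sum_(i < m.+1) Y i t)
                   / Num.sqrt (m.+1%:R * fine 'E_P[fun t => Y ord0 t ^+ 2]) <= y])
         - Phi y |
      <= C / Num.sqrt m.+1%:R * fine 'E_P[fun t => `|Y ord0 t| ^+ 3]
           / (fine 'E_P[fun t => Y ord0 t ^+ 2]) `^ (3 / 2).

(* Main.v *)
(* The sum S of the n variables is again generalized Poisson, with parameter
   n * lam: this is Abel's binomial identity for the polynomials
   x (x + k a)^(k - 1), which form a sequence with A_k'(x) = k A_(k-1)(x + a).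
   The same relation turns the partial sums of the masses into a differential
   recursion in the parameter, from which comparison shows that the masses sum
   to 1 when a < 1.  For another parameter mu, the likelihood ratio of the two
   laws of S at s is monotone in s, so on a tail it is at most its value at n z,
   and P(tail | lam) <= ratio(n z) * P(tail | mu).  Bounding the last probability
   by 1 gives the first bound for mu = (1 - a) z and the second one for mu = nu,
   the minimiser over mu.  For a = 0 and mu = z it is the probability that a
   Poisson sum is on one side of its mean, which Berry-Esseen bounds, with
   E|Y|^3 <= (E Y^4)^(3/4) and E Y^4 = 3 z^2 + z for the centered variable Y. *)
Require Import Defs.
From HB Require Import structures.
From mathcomp Require Import all_boot all_order all_algebra.
From mathcomp Require Import all_classical all_reals all_analysis.
From mathcomp Require Import measurable_realfun.
From mathcomp Require Import ring lra.
Import Order.TTheory GRing.Theory Num.Theory.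
Import numFieldNormedType.Exports.
Local Open Scope classical_set_scope.
Local Open Scope ring_scope.

(** * Abel polynomials *)

Section abel.
Context {R : realType}.
Implicit Types (a x y : R) (n : nat).

(** The polynomial [x (x + n a)^(n - 1)]. For [n = 0] the exponent [-1] cancels the factor [x],
    hence the separate value [1]. *)
Definition abel_poly a n : {poly R} :=
  if n is m.+1 then 'X * ('X + (m.+1%:R * a)%:P) ^+ m else 1.

Lemma horner_abel_polyS a m x :
  (abel_poly a m.+1).[x] = x * (x + m.+1%:R * a) ^+ m.
Proof. by rewrite /abel_poly !hornerE. Qed.

Lemma deriv_abel_poly a n :
  (abel_poly a n.+1)^`() = n.+1%:R *: (abel_poly a n \Po ('X + a%:P)).
Proof.
case: n => [|n]; first by rewrite /= expr0 mulr1 derivX comp_polyC scale1r.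
have -> : abel_poly a n.+1 \Po ('X + a%:P) =
    ('X + a%:P) * ('X + (n.+2%:R * a)%:P) ^+ n.
  rewrite /abel_poly comp_polyM comp_polyX; congr (_ * _).
  rewrite rmorphXn /= comp_polyD comp_polyX comp_polyC -addrA -polyCD.
  by congr (('X + _%:P) ^+ _); rewrite -[n.+2%:R]natr1; ring.
rewrite /abel_poly derivM derivX mul1r deriv_exp derivD derivX derivC addr0.
rewrite mul1r /= exprS -mul_polyC polyCM polyC_natr -mulr_natr.
by rewrite -[n.+2%:R]natr1; ring.
Qed.

Lemma poly_eq_deriv (p q : {poly R}) : p^`() = q^`() -> p.[0] = q.[0] -> p = q.
Proof.
move=> dpq pq0; apply/polyP => -[|i]; first by rewrite -!horner_coef0.
have := congr1 (fun p : {poly R} => p`_i) dpq; rewrite /= !coef_deriv.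
by move/eqP; rewrite eqrMn2r => /eqP.
Qed.

(** Induction on [n]: the derivative of either side for [n + 1] is [n + 1] times the identity for
    [n], shifted by [a], and at [0] only the term [k = 0] survives on the left. *)
Lemma abel_identity_poly a n y :
  \sum_(k < n.+1) ((abel_poly a (n - k)).[y] *+ 'C(n, k)) *: abel_poly a k
  = abel_poly a n \Po ('X + y%:P).
Proof.
elim: n => [|n IH].
  by rewrite big_ord_recl big_ord0 addr0 /= comp_polyC hornerC bin0 scale1r.
apply: poly_eq_deriv.
  rewrite deriv_comp derivD derivX derivC addr0 mulr1 deriv_abel_poly.
  rewrite comp_polyZ -comp_polyA comp_polyD comp_polyX comp_polyC.
  transitivity (n.+1%:R *: (abel_poly a n \Po ('X + y%:P) \Po ('X + a%:P)));
    last first.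
    congr (_ *: _); rewrite -comp_polyA comp_polyD comp_polyX comp_polyC.
    by congr (_ \Po _); rewrite -!addrA [X in _ + X]addrC.
  rewrite -IH raddf_sum big_ord_recl /= derivZ derivC scaler0 add0r.
  rewrite raddf_sum scaler_sumr; apply: eq_bigr => i _.
  rewrite /= derivZ -/(abel_poly a i.+1) deriv_abel_poly comp_polyZ !scalerA.
  congr (_ *: _); rewrite mulr_natr mulr_natl -!mulrnA /bump /= add1n subSS.
  by congr (_ *+ _); rewrite mulnC [RHS]mulnC mul_bin_diag.
rewrite horner_comp !hornerE horner_sum big_ord_recl big1 => [|i _].
  by rewrite addr0 hornerZ /= bin0 hornerC mulr1 !hornerE.
by rewrite hornerZ /= hornerM hornerX mul0r mulr0.
Qed.

Lemma abel_identity a n x y :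
  \sum_(k < n.+1) (abel_poly a k).[x] * (abel_poly a (n - k)).[y] *+ 'C(n, k)
  = (abel_poly a n).[x + y].
Proof.
have := congr1 (fun p : {poly R} => p.[x]) (abel_identity_poly a n y).
rewrite /= horner_comp !hornerE horner_sum => <-.
by apply: eq_bigr => i _; rewrite hornerZ [RHS]mulrC mulrnAr.
Qed.

Lemma abel_poly_ge0 a n x : 0 <= a -> 0 <= x -> 0 <= (abel_poly a n).[x].
Proof.
move=> a0 x0; case: n => [|n]; first by rewrite hornerC.
by rewrite horner_abel_polyS mulr_ge0// exprn_ge0// addr_ge0// mulr_ge0.
Qed.

(** * Partial sums of the masses as functions of the parameter *)

Lemma ge0_derive_le (f df : R -> R) x : 0 <= x ->
  (forall y, is_derive y (1 : R) f (df y)) -> (forall y, 0 < y -> 0 <= df y) ->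
  f 0 <= f x.
Proof.
move=> x0 fd df0; apply: (@ger0_derive1_ndecr _ f 0 x) => //.
- by move=> y; rewrite in_itv/= => /andP[y0 _]; rewrite derive1E derive_val df0.
- apply: continuous_subspaceT => y; apply: differentiable_continuous.
  exact/derivable1_diffP.
Qed.

(** Up to the factor [expR (- x)], this is the mass that the law with parameter [x] puts on
    [0, ..., N]. With that factor removed, differentiation lowers [N] by one and shifts [x] by [a],
    at the cost of a constant. *)
Definition borel_poly a N : {poly R} :=
  \sum_(s < N.+1) (expR (- (s%:R * a)) / s`!%:R) *: abel_poly a s.

Lemma horner_borel_poly0 a N : (borel_poly a N).[0] = 1.
Proof.
rewrite /borel_poly horner_sum big_ord_recl big1 => [|i _].
  by rewrite hornerZ hornerC mul0r oppr0 expR0 divr1 mul1r addr0.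
by rewrite hornerZ /= hornerM hornerX mul0r mulr0.
Qed.

Lemma deriv_borel_poly a N :
  (borel_poly a N.+1)^`() = expR (- a) *: (borel_poly a N \Po ('X + a%:P)).
Proof.
rewrite /borel_poly raddf_sum big_ord_recl /= derivZ derivC scaler0 add0r.
rewrite raddf_sum scaler_sumr; apply: eq_bigr => i _.
rewrite /= derivZ -/(abel_poly a i.+1) deriv_abel_poly comp_polyZ !scalerA.
congr (_ *: _); rewrite /bump /= add1n -[i.+1%:R]natr1 mulrDl mul1r opprD expRD.
rewrite factS natrM natr1 invfM.
have : i.+1%:R != 0 :> R by rewrite pnatr_eq0.
have : i`!%:R != 0 :> R by rewrite pnatr_eq0 -lt0n fact_gt0.
by move: (i`!%:R) (i.+1%:R : R) => u v u0 v0; field; rewrite u0 v0.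
Qed.

Lemma horner_deriv_borel_poly a N x :
  (borel_poly a N.+1)^`().[x] = expR (- a) * (borel_poly a N).[x + a].
Proof. by rewrite deriv_borel_poly hornerZ horner_comp !hornerE. Qed.

Lemma borel_poly_ge0 a N x : 0 <= a -> 0 <= x -> 0 <= (borel_poly a N).[x].
Proof.
move=> a0 x0; rewrite horner_sum sumr_ge0// => i _.
by rewrite hornerZ mulr_ge0 ?abel_poly_ge0// divr_ge0// expR_ge0.
Qed.

(** Induction on [N]: the difference of the two sides vanishes at [0], and its derivative has the
    right sign by the bound for the previous index at [x + a], because
    [expR (- a) * expR (x + a) = expR x]. *)
Lemma borel_poly_le a N x : 0 <= a -> 0 <= x -> (borel_poly a N).[x] <= expR x.
Proof.
move=> a0; elim: N x => [|N IH] x x0.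
  rewrite /borel_poly big_ord_recl big_ord0 addr0 hornerZ hornerC.
  rewrite mul0r oppr0 expR0 divr1 mul1r; have := expR_ge1Dx x; lra.
rewrite -subr_ge0.
have <- : expR 0 - (borel_poly a N.+1).[0] = 0.
  by rewrite expR0 horner_borel_poly0 subrr.
apply: (@ge0_derive_le (fun x => expR x - (borel_poly a N.+1).[x])
  (fun x => expR x - (borel_poly a N.+1)^`().[x])) => // y y0.
rewrite horner_deriv_borel_poly subr_ge0.
rewrite -[leRHS](@mulKf _ (expR a)) ?gt_eqF ?expR_gt0// -expRN -expRD.
by rewrite ler_wpM2l ?expR_ge0// addrC IH// addr_ge0// ltW.
Qed.

(* [x / ((1 - a) (N + 1))] is what Markov's inequality gives for the tail beyond
   [N], since the mean is [x / (1 - a)]; it is a supersolution of the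
   differential recursion that the tails satisfy. *)
Lemma borel_poly_ge a N x : 0 <= a < 1 -> 0 <= x ->
  expR x * (1 - x / ((1 - a) * N.+1%:R)) <= (borel_poly a N).[x].
Proof.
move=> /andP[a0 a1]; have c0 : 0 < 1 - a by rewrite subr_gt0.
elim: N x => [|N IH] x x0.
  rewrite /borel_poly big_ord_recl big_ord0 addr0 hornerZ hornerC.
  rewrite mul0r oppr0 expR0 divr1 mul1r mulr1.
  rewrite -(@ler_pM2l _ (expR (- x))) ?expR_gt0// mulrA -expRD addNr expR0.
  rewrite mulr1 mul1r (le_trans _ (expR_ge1Dx _))// lerD2l lerN2.
  by rewrite ler_pdivlMr// ler_piMr//; lra.
pose k := ((1 - a) * N.+2%:R)^-1.
rewrite -subr_ge0 -/k.
have E0 : (borel_poly a N.+1).[0] - expR 0 * (1 - 0 * k) = 0.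
  by rewrite expR0 horner_borel_poly0 mul0r subr0 mulr1 subrr.
rewrite -[leLHS]E0.
pose df y : R := (borel_poly a N.+1)^`().[y] - expR y * (1 - y * k - k).
apply: (@ge0_derive_le (fun x => (borel_poly a N.+1).[x] - expR x * (1 - x * k))
  df) => // y.
  apply: trigger_derive; rewrite /df /=.
  by rewrite /GRing.scale /=; ring.
move=> y0; rewrite /df horner_deriv_borel_poly.
have ya : 0 <= y + a by rewrite addr_ge0// ltW.
have h1 : 0 <= expR (- a) * (borel_poly a N).[y + a].
  by rewrite mulr_ge0 ?expR_ge0// borel_poly_ge0.
have h2 : expR y * (1 - (y + a) / ((1 - a) * N.+1%:R)) <=
    expR (- a) * (borel_poly a N).[y + a].
  have := IH _ ya; rewrite -(@ler_pM2l _ (expR (- a))) ?expR_gt0// mulrA -expRD.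
  by rewrite addrCA addNr addr0.
have Np : 0 < N.+1%:R :> R by rewrite ltr0n.
have NS : N.+2%:R = N.+1%:R + 1 :> R by rewrite natr1.
have e0 := expR_gt0 y.
(* In the first case the inductive bound is not positive, but [y + 1 >= (1 - a) (N + 2)], so the
   quantity to be dominated is nonpositive too. In the second case the comparison of the two bounds,
   cleared of denominators, is [y + a <= (1 - a) (N + 1)]. *)
have [yN|yN] := leP ((1 - a) * N.+1%:R) (y + a).
  rewrite subr_ge0 (le_trans _ h1)// pmulr_rle0// -addrA -opprD subr_le0.
  by rewrite -[X in _ + X]mul1r -mulrDl /k ler_pdivlMr ?mulr_gt0// ?NS; lra.
rewrite subr_ge0 (le_trans _ h2)// ler_pM2l// -addrA lerD2l -opprD lerN2.
have -> : y * k + k = (y + 1) * k by ring.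
rewrite ler_pdivrMr ?mulr_gt0// -mulrA.
have -> : k * ((1 - a) * N.+1%:R) = N.+1%:R / N.+2%:R.
  rewrite /k NS; field; apply/andP; split; first lra.
  by rewrite gt_eqF.
rewrite mulrA ler_pdivlMr ?NS ?addr_gt0//; nra.
Qed.

End abel.

(** * Generalized Poisson masses *)

Section gen_poisson_mass.
Context {R : realType}.
Implicit Types (L M a : R) (s N : nat).

(* Agrees with [gen_poisson_pmf] for [L > 0], and is the point mass at [0] for
   [L = 0], where [gen_poisson_pmf] has the junk value [0]. *)
Definition gen_poisson_mass L a s : R :=
  (abel_poly a s).[L] * expR (- L - s%:R * a) / s`!%:R.

Lemma gen_poisson_massE L a s : 0 < L ->
  gen_poisson_mass L a s = gen_poisson_pmf L a s.
Proof.
move=> L0; rewrite /gen_poisson_mass /gen_poisson_pmf.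
case: s => [|s]; last by rewrite horner_abel_polyS intS addrAC subrr add0r.
by rewrite hornerC mul0r addr0 sub0r exprN1 mulfV ?gt_eqF.
Qed.

Lemma gen_poisson_mass_ge0 L a s : 0 <= a -> 0 <= L ->
  0 <= gen_poisson_mass L a s.
Proof.
by move=> a0 L0; rewrite divr_ge0// mulr_ge0 ?abel_poly_ge0 ?expR_ge0.
Qed.

Lemma gen_poisson_mass0 a s : gen_poisson_mass 0 a s = (s == 0)%:R.
Proof.
rewrite /gen_poisson_mass; case: s => [|s].
  by rewrite hornerC mul0r subr0 oppr0 expR0 divr1 mulr1.
by rewrite horner_abel_polyS !mul0r.
Qed.

(** The exponentials multiply to a common factor, and [1 / (k! (s - k)!)] is a binomial coefficient
    over [s!]; what is left is Abel's identity. *)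
Lemma gen_poisson_massD L M a s :
  \sum_(k < s.+1) gen_poisson_mass L a k * gen_poisson_mass M a (s - k)
  = gen_poisson_mass (L + M) a s.
Proof.
rewrite /gen_poisson_mass -abel_identity !mulr_suml; apply: eq_bigr => k _.
have ks : (k <= s)%N by rewrite -ltnS.
have -> : - (L + M) - s%:R * a = (- L - k%:R * a) + (- M - (s - k)%:R * a).
  by rewrite natrB//; ring.
rewrite [in RHS]expRD -(mulr_natr (_ * _) 'C(s, k)).
have f0 i : i`!%:R != 0 :> R by rewrite pnatr_eq0 -lt0n fact_gt0.
have -> : 'C(s, k)%:R = s`!%:R / (k`!%:R * (s - k)`!%:R) :> R.
  apply: (canRL (mulfK _)); first by rewrite mulf_neq0.
  by rewrite -!natrM bin_fact.
have := f0 s; have := f0 k; have := f0 (s - k)%N.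
by move: (s`!%:R) (k`!%:R) ((s - k)`!%:R) => u v w w0 v0 u0; field; apply/and3P.
Qed.

Lemma sum_gen_poisson_mass L a N :
  \sum_(s < N.+1) gen_poisson_mass L a s = expR (- L) * (borel_poly a N).[L].
Proof.
rewrite horner_sum mulr_sumr; apply: eq_bigr => s _.
by rewrite hornerZ /gen_poisson_mass expRD; ring.
Qed.

(** The two comparisons squeeze the sum over [s <= N] between [1 - L / ((1 - a) (N + 1))] and
    [1]. *)
Lemma cvg_sum_gen_poisson_mass L a : 0 <= a < 1 -> 0 <= L ->
  \sum_(s < N) gen_poisson_mass L a s @[N --> \oo] --> (1 : R).
Proof.
move=> a01 L0; have /andP[a0 a1] := a01.
rewrite -cvg_shiftS /=.
have e0 : expR L != 0 by rewrite gt_eqF ?expR_gt0.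
apply: (@squeeze_cvgr _ _ _ _ (fun N => 1 - L / (1 - a) * harmonic N) (cst 1)).
- near=> N; apply/andP; split; rewrite sum_gen_poisson_mass expRN.
    rewrite ler_pdivlMl ?expR_gt0//.
    by have := borel_poly_ge a N L a01 L0; rewrite invfM mulrA.
  by rewrite ler_pdivrMl ?expR_gt0// mulr1 borel_poly_le.
- have : (1 - L / (1 - a) * harmonic N) @[N --> \oo] --> 1 - L / (1 - a) * 0.
    apply: cvgB; first exact: cvg_cst.
    by apply: cvgM; [exact: cvg_cst|exact: cvg_harmonic].
  by rewrite mulr0 subr0.
- exact: cvg_cst.
Unshelve. all: end_near. Qed.

Lemma nneseries_gen_poisson_mass L a : 0 <= a < 1 -> 0 <= L ->
  (\sum_(0 <= s <oo) (gen_poisson_mass L a s)%:E = 1)%E.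
Proof.
move=> a01 L0; apply/cvg_lim => //.
under eq_fun do rewrite sumEFin.
apply: cvg_EFin; first exact: nearW.
under eq_fun do rewrite /= big_mkord.
exact: cvg_sum_gen_poisson_mass.
Qed.

End gen_poisson_mass.

(** * The law of the sum *)

Section sum_law.
Context {R : realType} {d : measure_display} {T : measurableType d}.
Context {P : probability T R} {n : nat} {X : 'I_n -> {RV P >-> R}} {lam a : R}.
Hypotheses (lam0 : 0 <= lam) (a01 : 0 <= a < 1).
Hypothesis indepX : mutually_independent X.
Hypothesis massX : forall i k,
  P (X i @^-1` [set k%:R]) = (gen_poisson_mass lam a k)%:E.

Let a0 : 0 <= a. Proof. by case/andP: a01. Qed.

Let N : set R := range (fun k : nat => k%:R).

Let measurable_N : measurable N.
Proof. by apply: countable_measurable => //; exact: card_image_le. Qed.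

(** The masses at the natural numbers already exhaust the total probability. *)
Let PXN i : P (X i @^-1` N) = 1%E.
Proof.
have -> : X i @^-1` N = \bigcup_k X i @^-1` [set k%:R].
  by apply/seteqP; split => t [k _ kE]; exists k.
rewrite measure_bigcup//.
- rewrite -(@nneseries_gen_poisson_mass R lam a)//.
  by rewrite eseries_mkcond; apply: eq_eseriesr => k _; rewrite in_setT /= massX.
- by apply/trivIsetP => j k _ _ /eqP jk; apply/seteqP; split => // t /= [-> /eqP];
    rewrite eqr_nat => /eqP /jk.
Qed.

(** The first [m] variables are natural numbers with sum [s], the others lie in prescribed sets.
    Keeping these sets arbitrary lets an induction on [m] fix the value of the next variable and
    still use the product rule. *)
Let evt m s (B : 'I_n -> set R) := [set t |
  \sum_(i < n | (i < m)%N) X i t = s%:R /\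
  forall i : 'I_n, (if (i < m)%N then N else B i) (X i t)].

Let measurable_all (B : 'I_n -> set R) : (forall i, measurable (B i)) ->
  measurable [set t | forall i, B i (X i t)].
Proof.
move=> mB; rewrite (_ : [set _ | _] = \bigcap_(i in [set: 'I_n]) X i @^-1` B i).
  by apply: fin_bigcap_measurable => // i _; exact: measurable_funPTI.
by apply/seteqP; split => t /= h i; [move=> _|]; exact: h.
Qed.

Let measurable_psum m :
  measurable_fun [set: T] (fun t => \sum_(i < n | (i < m)%N) X i t).
Proof.
under eq_fun do rewrite big_mkcond/=.
by apply: measurable_sum => i; case: (i < m)%N.
Qed.

Let measurable_evt m s B : (forall i, measurable (B i)) ->
  measurable (evt m s B).
Proof.
move=> mB; apply: measurableI; last first.
  by apply: (measurable_all (fun i => if (i < m)%N then N else B i)) => i; case: ifP.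
rewrite -[X in measurable X]setTI.
by apply: (measurable_psum m _ [set s%:R]).
Qed.

(** Induction on [m]: split by the value [k <= s] of the last of the [m + 1] variables and sum with
    the convolution rule. Subadditivity gives only an inequality, which is enough, since equality
    follows later from the total mass. *)
Let evt_le m s B : (m <= n)%N -> (forall i, measurable (B i)) ->
  (P (evt m s B) <= (gen_poisson_mass (m%:R * lam) a s *
     \prod_(i < n | (m <= i)%N) fine (P (X i @^-1` B i)))%:E)%E.
Proof.
elim: m s B => [|m IH] s B mn mB.
  rewrite mul0r gen_poisson_mass0; case: eqP => [->|s0]; last first.
    rewrite mul0r (_ : evt _ _ _ = set0) ?measure0//.
    apply/seteqP; split => // t [/eqP]; rewrite big_pred0// eq_sym pnatr_eq0.
    by move=> /eqP /s0.
  have sub : evt 0 0 B `<=` [set t | forall i, B i (X i t)] by move=> t [_].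
  rewrite mul1r -prodEFin; apply: le_trans (le_measure P _ _ sub) _.
  - by rewrite inE; exact: measurable_evt.
  - by rewrite inE; exact: measurable_all.
  rewrite [leLHS](indepX _ mB) [leLHS](_ : _ = \prod_(i < n) (fine (P (X i @^-1` B i)))%:E)%E//.
  apply: eq_bigr => i _; rewrite fineK// fin_num_measure//.
  exact: measurable_funPTI.
pose j := Ordinal mn.
pose B' (k : nat) i := if i == j then [set k%:R] else B i.
have mB' k i : measurable (B' k i) by rewrite /B'; case: ifP.
have sub : evt m.+1 s B `<=` \big[setU/set0]_(k < s.+1) evt m (s - k) (B' k).
  move=> t [St Bt]; rewrite -(bigcup_mkord s.+1 (fun k => evt m (s - k) (B' k))).
  have [k _ kE] : N (X j t) by have := Bt j; rewrite /= ltnSn.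
  have Sm : \sum_(i < n | (i < m.+1)%N) X i t =
      \sum_(i < n | (i < m)%N) X i t + k%:R.
    rewrite (bigD1 j)//= kE addrC; congr (_ + _); apply: eq_bigl => i.
    by rewrite ltnS ltn_neqAle andbC.
  have Sm0 : 0 <= \sum_(i < n | (i < m)%N) X i t.
    apply: sumr_ge0 => i im; have := Bt i; rewrite (ltn_trans im)//.
    by move=> [l _ <-].
  have ks : (k <= s)%N by rewrite -(ler_nat R) -St Sm lerDr.
  exists k => //; split; first by rewrite natrB// -St Sm addrK.
  move=> i; have := Bt i; rewrite /B' ltnS leq_eqVlt.
  have [->|ij] := eqVneq i j; first by rewrite ltnn kE.
  by case: eqP => //= im; case/eqP: ij; exact: val_inj.
apply: le_trans (@content_subadditive _ _ _ P _
  (fun k => evt m (s - k) (B' k)) _ _ _ sub) _.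
- by move=> k _; exact: measurable_evt.
- exact: measurable_evt.
apply: (@le_trans _ _ (\sum_(k < s.+1) (gen_poisson_mass (m%:R * lam) a (s - k) *
   \prod_(i < n | (m <= i)%N) fine (P (X i @^-1` B' k i)))%:E)%E).
  by apply: lee_sum => k _; exact: (IH (s - k)%N (B' k) (ltnW mn) (mB' k)).
rewrite sumEFin lee_fin -natr1 mulrDl mul1r addrC -gen_poisson_massD mulr_suml.
apply: ler_sum => k _; rewrite (bigD1 j)//= {1}/B' eqxx massX /=.
rewrite mulrA [X in X * _]mulrC le_eqVlt; apply/orP; left; apply/eqP.
congr (_ * _); apply: eq_big => [i|i /andP[_ /negPf ij]]; last by rewrite /B' ij.
by rewrite ltn_neqAle andbC eq_sym.
Qed.

Let S t := \sum_(i < n) X i t.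

Let measurable_S (c : pred R) : measurable [set x : R | c x] -> measurable [set t | c (S t)].
Proof.
move=> mc; rewrite -[X in measurable X]setTI.
have mS : measurable_fun [set: T] S by exact: measurable_sum.
exact: (mS _ [set x | c x]).
Qed.

(** Outside a null set all variables are natural numbers; there the event is covered by the events
    where the sum is some [s] satisfying [c]. *)
Let PS_le (c : pred R) : measurable [set x | c x] ->
  (P [set t | c (S t)] <=
   \sum_(0 <= s <oo | c s%:R) (gen_poisson_mass (n%:R * lam) a s)%:E)%E.
Proof.
move=> mc.
pose L := [set t | forall i, N (X i t)].
have mL : measurable L by exact: (measurable_all (fun=> N)).
have mcS := measurable_S _ mc.
have PL : P (~` L) = 0%E.
  rewrite probability_setC// (indepX (fun=> N))//.
  by under eq_bigr do rewrite PXN; rewrite big1// subee.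
have -> : P [set t | c (S t)] = P ([set t | c (S t)] `&` L).
  have mLC : measurable (~` L) by exact: measurableC.
  rewrite -[LHS](measureU0 mcS mLC PL) -[RHS](measureU0 _ mLC PL).
    by rewrite setUIl setUv setIT.
  exact: measurableI.
pose F s := if c s%:R then evt n s (fun=> setT) else set0.
have mF s : measurable (F s).
  by rewrite /F; case: ifP => // _; exact: measurable_evt.
apply: le_trans (measure_sigma_subadditive P mF _ _) _.
- exact: measurableI.
- move=> t [/= ct Lt].
  have [s Ss] : exists s : nat, S t = s%:R.
    rewrite /S; elim/big_ind : _ => [|x y [k ->] [l ->]|i _]; first by exists 0%N.
      by exists (k + l)%N; rewrite natrD.
    by have [k _ <-] := Lt i; exists k.
  exists s => //; rewrite /F -Ss ct; split.
    by rewrite -Ss; apply: eq_bigl => i; rewrite ltn_ord.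
  by move=> i; rewrite ltn_ord.
rewrite [leRHS]eseries_mkcond; apply: lee_nneseries => // s _.
rewrite /F; case: ifP => _; last by rewrite measure0.
have := evt_le n s (fun=> setT) (leqnn n) (fun=> measurableT).
by rewrite big_pred0 ?mulr1// => i; rewrite leqNgt ltn_ord.
Qed.

(** The upper bounds for [c] and for its complement add up to [1], as do the probabilities, so
    neither bound can be strict. *)
Lemma gen_poisson_sum_law (c : pred R) : measurable [set x | c x] ->
  (P [set t | c (\sum_(i < n) X i t)%R] =
   \sum_(0 <= s <oo | c s%:R) (gen_poisson_mass (n%:R * lam) a s)%:E)%E.
Proof.
move=> mc; apply/eqP; rewrite eq_le PS_le//=.
pose c' : pred R := fun x => ~~ c x.
have c'E : [set x | c' x] = ~` [set x | c x].
  by apply/seteqP; split => x /= /negP.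
have mc' : measurable [set x | c' x] by rewrite c'E; exact: measurableC.
have := PS_le _ mc'; rewrite -/S.
have -> : [set t | c' (S t)] = ~` [set t | c (S t)].
  by apply/seteqP; split => x /= /negP.
rewrite probability_setC; last exact: measurable_S.
have m0 s : (0 <= (gen_poisson_mass (n%:R * lam) a s)%:E)%E.
  by rewrite lee_fin gen_poisson_mass_ge0// mulr_ge0.
set v := (\sum_(0 <= s <oo | c' s%:R) _)%E => h.
have uv : (\sum_(0 <= s <oo | c s%:R) (gen_poisson_mass (n%:R * lam) a s)%:E
    + v = 1)%E.
  rewrite -(@nneseries_gen_poisson_mass R (n%:R * lam) a)// ?mulr_ge0//.
  rewrite /v eseries_mkcond [X in (_ + X)%E]eseries_mkcond -nneseriesD//.
  - by apply: eq_eseriesr => s _; rewrite /c'; case: (c _); rewrite /= ?adde0 ?add0e.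
  - by move=> i _ _; case: ifP.
  - by move=> i _ _; case: ifP.
move: uv h; set u := (\sum_(0 <= s <oo | c s%:R) _)%E.
have u0 : (0 <= u)%E by apply: nneseries_ge0.
have v0 : (0 <= v)%E by apply: nneseries_ge0.
have : P [set t | c (S t)] \is a fin_num.
  by apply: fin_num_measure; exact: measurable_S.
move: (P _) u v u0 v0 => [p| |] [u| |] [v| |]//= _ _ _ [uv].
by rewrite !lee_fin; lra.
Qed.

End sum_law.

(** * Likelihood ratios *)

Section change_of_parameter.
Context {R : realType}.
Implicit Types (L M a x y z : R).

Lemma ln_le_subr1 x : 0 < x -> ln x <= x - 1.
Proof.
move=> x0; have := @le_ln1Dx R (x - 1); rewrite addrCA subrr addr0.
by apply; lra.
Qed.

(** This is the monotonicity of the logarithm of the likelihood ratio. The difference of logarithms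
    decreases in [x], but more slowly than the factor in front grows. *)
Lemma ler_ln_ratio L M a x y : 0 < M <= L -> 0 <= a -> 0 <= x <= y ->
  (x - 1) * (ln (L + x * a) - ln (M + x * a)) <=
  (y - 1) * (ln (L + y * a) - ln (M + y * a)).
Proof.
move=> /andP[M0 ML] a0 /andP[x0 xy].
have xa0 : 0 <= x * a by rewrite mulr_ge0.
have xya : x * a <= y * a by rewrite ler_wpM2r.
set Lx := L + x * a; set Mx := M + x * a.
set Ly := L + y * a; set My := M + y * a.
have [Mx0 My0 Lx0 Ly0] : [/\ 0 < Mx, 0 < My, 0 < Lx & 0 < Ly].
  by rewrite /Lx /Ly /Mx /My; split; lra.
set Dx := ln Lx - ln Mx; set Dy := ln Ly - ln My.
(* A common yardstick: [ln u <= u - 1] bounds [Dy] below by [w] and the drop [Dx - Dy] above by a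
   multiple of [w]. *)
pose w := (L - M) / Ly.
have w0 : 0 <= w by rewrite divr_ge0 ?subr_ge0// ltW.
have Dyw : w <= Dy.
  have := ln_le_subr1 (My / Ly); rewrite ln_div ?posrE// divr_gt0//.
  have -> : My / Ly = 1 - w by rewrite /w /My /Ly; field; rewrite -/Ly gt_eqF.
  by move=> /(_ isT); rewrite /Dy; lra.
have Dxy0 : Dy <= Dx.
  rewrite /Dx /Dy lerBlDr addrAC lerBrDr -!lnM ?posrE// ler_ln ?posrE ?mulr_gt0//.
  by rewrite /Lx /Ly /Mx /My; nra.
have Dxy : Dx - Dy <= (y - x) * (a / Mx) * w.
  have LM0 : 0 < Lx * My by rewrite mulr_gt0.
  have ML0 : 0 < Mx * Ly by rewrite mulr_gt0.
  have := ln_le_subr1 (Lx * My / (Mx * Ly)).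
  rewrite divr_gt0// ln_div ?posrE// !lnM ?posrE//.
  have -> : Lx * My / (Mx * Ly) = 1 + (y - x) * (a / Mx) * w.
    rewrite /w; have := gt_eqF Mx0; have := gt_eqF Ly0.
    rewrite /Lx /Ly /Mx /My => h1 h2; field; rewrite h1 h2//.
  by move=> /(_ isT); rewrite /Dx /Dy; lra.
rewrite -subr_ge0.
have -> : (y - 1) * Dy - (x - 1) * Dx = (y - x) * Dy - (x - 1) * (Dx - Dy) by ring.
have yx0 : 0 <= y - x by lra.
have D0 : 0 <= Dx - Dy by lra.
(* For [x <= 1] both terms help. Otherwise [x - 1] is enlarged to [x], and [x a <= Mx] bounds the
   loss by [(y - x) w], hence by the gain [(y - x) Dy]. *)
have [x1|x1] := leP x 1.
  rewrite addr_ge0 ?mulr_ge0//; first exact: le_trans Dyw.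
  by rewrite -mulNr mulr_ge0//; lra.
rewrite subr_ge0 (@le_trans _ _ (x * (Dx - Dy)))//.
  by rewrite ler_wpM2r//; lra.
rewrite (@le_trans _ _ (x * ((y - x) * (a / Mx) * w)))// ?ler_wpM2l//.
rewrite (@le_trans _ _ ((y - x) * w))// ?ler_wpM2l//.
have -> : x * ((y - x) * (a / Mx) * w) = (y - x) * w * (x * a / Mx) by ring.
apply: ler_piMr; first by rewrite mulr_ge0.
rewrite ler_pdivrMr// mul1r.
by rewrite /Mx; lra.
Qed.

(** The quotient [(L / M) ((L + y a) / (M + y a))^(y - 1) e^(M - L)] of the masses. The exponential
    form makes sense at the non-integer point [n z] and reduces monotonicity to the exponent. *)
Definition likelihood_ratio L M a y : R :=
  L / M * expR ((y - 1) * (ln (L + y * a) - ln (M + y * a)) + M - L).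

Lemma likelihood_ratio_ge0 L M a y : 0 < L -> 0 < M ->
  0 <= likelihood_ratio L M a y.
Proof. by move=> /ltW ? /ltW ?; rewrite mulr_ge0 ?expR_ge0// divr_ge0. Qed.

Lemma gen_poisson_mass_ratio L M a s : 0 <= a -> 0 < L -> 0 < M ->
  gen_poisson_mass L a s = likelihood_ratio L M a s%:R * gen_poisson_mass M a s.
Proof.
move=> a0 L0 M0; rewrite /gen_poisson_mass /likelihood_ratio !expRD.
have eM0 : expR M != 0 by rewrite gt_eqF ?expR_gt0.
have eL0 : expR L != 0 by rewrite gt_eqF ?expR_gt0.
have [M_ L_] : M != 0 /\ L != 0 by split; rewrite gt_eqF.
rewrite !expRN; case: s => [|s].
  rewrite !hornerC !mul0r !addr0 sub0r mulN1r opprB expRD expRN !lnK ?posrE//.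
  by rewrite expR0 fact0; field; rewrite L_ M_ eM0 eL0.
have Ls : 0 < L + s.+1%:R * a by rewrite ltr_pwDl// mulr_ge0.
have Ms : 0 < M + s.+1%:R * a by rewrite ltr_pwDl// mulr_ge0.
have -> : expR ((s.+1%:R - 1) * (ln (L + s.+1%:R * a) - ln (M + s.+1%:R * a))) =
    (L + s.+1%:R * a) ^+ s / (M + s.+1%:R * a) ^+ s.
  by rewrite -natr1 addrK natr1 mulrBr expRD expRN !expRM_natl !lnK ?posrE.
rewrite !horner_abel_polyS.
have pM : (M + s.+1%:R * a) ^+ s != 0 by rewrite expf_neq0// gt_eqF.
have es0 : expR (s.+1%:R * a) != 0 by rewrite gt_eqF ?expR_gt0.
have f0 : s.+1`!%:R != 0 :> R by rewrite pnatr_eq0 -lt0n fact_gt0.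
move: (L + _) (M + _) pM => u v; move: (u ^+ s) (v ^+ s) => {}u {}v v0.
move: (expR _) (expR _) (expR _) (s.+1`!%:R) eL0 eM0 es0 f0 => eL eM es f eL0 eM0 es0 f0.
by field; rewrite f0 eL0 eM0 es0 v0 M_.
Qed.

Lemma gen_poisson_mass_le_ratio L M a y s : 0 <= a -> 0 < L -> 0 < M ->
  (M <= L) && (s%:R <= y) || [&& L <= M, 0 <= y & y <= s%:R] ->
  gen_poisson_mass L a s <= likelihood_ratio L M a y * gen_poisson_mass M a s.
Proof.
move=> a0 L0 M0 h; rewrite (gen_poisson_mass_ratio L M)//.
apply: ler_wpM2r; first by rewrite gen_poisson_mass_ge0// ltW.
apply: ler_wpM2l; first by rewrite divr_ge0 ?ltW.
rewrite ler_expR !lerD2r.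
case/orP: h => [/andP[ML sy]|/and3P[LM y0 ys]].
  by apply: ler_ln_ratio; rewrite // ?M0 ?ler0n.
(* Exchanging the parameters negates the logarithmic term, so for [L <= M] the ratio is
   nonincreasing. *)
rewrite -lerN2 -!mulrN !opprB.
by apply: ler_ln_ratio; rewrite // ?L0 ?y0.
Qed.

(** The factors [n] cancel inside the logarithms. In the exponent [n z - 1], the part [n z] produces
    the [n]-th power and the [-1] the prefactor. *)
Lemma likelihood_ratioMn (n : nat) lam mu a z : (0 < n)%N -> 0 < lam -> 0 < mu ->
  0 <= a -> 0 < z ->
  likelihood_ratio (n%:R * lam) (n%:R * mu) a (n%:R * z) =
  lam * (mu + z * a) / (mu * (lam + z * a)) *
  (((lam + z * a) / (mu + z * a)) `^ z * expR mu / expR lam) ^+ n.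
Proof.
move=> n0 lam0 mu0 a0 z0.
have nR : 0 < n%:R :> R by rewrite ltr0n.
have za : 0 <= z * a by rewrite mulr_ge0// ltW.
have lz : 0 < lam + z * a by rewrite ltr_pwDl.
have mz : 0 < mu + z * a by rewrite ltr_pwDl.
have -> : ((lam + z * a) / (mu + z * a)) `^ z * expR mu / expR lam =
    expR (z * (ln (lam + z * a) - ln (mu + z * a)) + mu - lam).
  rewrite /powR gt_eqF ?divr_gt0// ln_div ?posrE//.
  by rewrite [in RHS]expRD [in RHS]expRD expRN.
have nzE x : n%:R * x + n%:R * z * a = n%:R * (x + z * a) by ring.
rewrite /likelihood_ratio !nzE !lnM ?posrE// -expRM_natl.
have -> : (n%:R * z - 1) *
    (ln n%:R + ln (lam + z * a) - (ln n%:R + ln (mu + z * a))) +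
    n%:R * mu - n%:R * lam = (ln (mu + z * a) - ln (lam + z * a)) +
    n%:R * (z * (ln (lam + z * a) - ln (mu + z * a)) + mu - lam) by ring.
rewrite expRD [expR (ln _ - _)]expRD expRN !lnK ?posrE//.
by field; rewrite !gt_eqF.
Qed.

End change_of_parameter.

(** * Tail bounds *)

Section tail_bounds.
Context {R : realType} {d : measure_display} {T : measurableType d}.
Context {P : probability T R} {n : nat} {X : 'I_n -> {RV P >-> R}} {lam a : R}.
Hypotheses (lam0 : 0 < lam) (a01 : 0 <= a < 1) (n0 : (0 < n)%N).
Hypothesis indepX : mutually_independent X.
Hypothesis massX : forall i k,
  P (X i @^-1` [set k%:R]) = (gen_poisson_mass lam a k)%:E.

Let a0 : 0 <= a. Proof. by case/andP: a01. Qed.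
Let nR : 0 < n%:R :> R. Proof. by rewrite ltr0n. Qed.

(** The likelihood ratio at [n z] between the laws of the sum for [lam] and for [mu]. *)
Definition tilted_bound (mu z : R) : R :=
  lam * (mu + z * a) / (mu * (lam + z * a)) *
  (((lam + z * a) / (mu + z * a)) `^ z * expR mu / expR lam) ^+ n.

Let tilted_tail mu z (c : pred R) : 0 < mu -> 0 < z -> measurable [set x | c x] ->
  (forall s : nat, c s%:R ->
    (mu <= lam) && (s%:R <= n%:R * z) || (lam <= mu) && (n%:R * z <= s%:R)) ->
  (P [set t | c (\sum_(i < n) X i t)%R] <= (tilted_bound mu z)%:E *
    \sum_(0 <= s <oo | c s%:R) (gen_poisson_mass (n%:R * mu) a s)%:E)%E.
Proof.
move=> mu0 z0 mc cs; rewrite (gen_poisson_sum_law (ltW lam0) a01)//.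
have nm0 : 0 < n%:R * mu by rewrite mulr_gt0.
have nl0 : 0 < n%:R * lam by rewrite mulr_gt0.
rewrite /tilted_bound -likelihood_ratioMn// -nneseriesZl; last first.
  by move=> s _; rewrite lee_fin gen_poisson_mass_ge0// ltW.
apply: lee_nneseries => [s _ _|s /cs h].
  by rewrite lee_fin gen_poisson_mass_ge0// ltW.
rewrite lee_fin; apply: gen_poisson_mass_le_ratio => //.
by rewrite !ler_pM2l// (mulr_ge0 (ltW nR) (ltW z0)).
Qed.

Lemma mean_leE z :
  [set t | ((\sum_(i < n) X i t) / n%:R <= z)%R] =
  [set t | (\sum_(i < n) X i t <= n%:R * z)%R].
Proof. by apply/seteqP; split => t /=; rewrite ler_pdivrMr// mulrC. Qed.

Lemma mean_geE z :
  [set t | (z <= (\sum_(i < n) X i t) / n%:R)%R] =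
  [set t | (n%:R * z <= \sum_(i < n) X i t)%R].
Proof. by apply/seteqP; split => t /=; rewrite ler_pdivlMr// mulrC. Qed.

Let measurable_le x : measurable [set y : R | y <= x].
Proof. by rewrite -set_itvE. Qed.

Let measurable_ge x : measurable [set y : R | x <= y].
Proof. by rewrite -set_itvE. Qed.

Lemma gen_poisson_lower_tail mu z : 0 < mu <= lam -> 0 < z ->
  (P [set t | ((\sum_(i < n) X i t) / n%:R <= z)%R] <= (tilted_bound mu z)%:E *
    \sum_(0 <= s <oo | (s%:R <= n%:R * z)%R) (gen_poisson_mass (n%:R * mu) a s)%:E)%E.
Proof.
move=> /andP[mu0 ml] z0; rewrite mean_leE.
apply: (tilted_tail mu z (fun x => x <= n%:R * z)) => // s sz.
by rewrite ml sz.
Qed.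

Lemma gen_poisson_upper_tail mu z : lam <= mu -> 0 < z ->
  (P [set t | (z <= (\sum_(i < n) X i t) / n%:R)%R] <= (tilted_bound mu z)%:E *
    \sum_(0 <= s <oo | (n%:R * z <= s%:R)%R) (gen_poisson_mass (n%:R * mu) a s)%:E)%E.
Proof.
move=> ml z0; rewrite mean_geE.
apply: (tilted_tail mu z (fun x => n%:R * z <= x)) => // [|s sz].
  exact: lt_le_trans ml.
by rewrite ml sz orbT.
Qed.

Lemma tilted_bound_ge0 mu z : 0 < mu -> 0 < z -> 0 <= tilted_bound mu z.
Proof.
move=> mu0 z0; rewrite /tilted_bound -likelihood_ratioMn//.
by rewrite likelihood_ratio_ge0 ?mulr_gt0.
Qed.

Let tilted_bound_mule_le mu z (c : pred nat) : 0 < mu -> 0 < z ->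
  ((tilted_bound mu z)%:E *
    \sum_(0 <= s <oo | c s) (gen_poisson_mass (n%:R * mu) a s)%:E <=
   (tilted_bound mu z)%:E)%E.
Proof.
move=> mu0 z0; have nm0 : 0 <= n%:R * mu by rewrite ltW// mulr_gt0.
rewrite -[leRHS]mule1; apply: lee_wpmul2l.
  by rewrite lee_fin tilted_bound_ge0.
rewrite -[leRHS](nneseries_gen_poisson_mass (n%:R * mu) a)//.
by apply: subset_lee_nneseries => // s _; rewrite lee_fin gen_poisson_mass_ge0.
Qed.

Lemma gen_poisson_lower_tail_le mu z : 0 < mu <= lam -> 0 < z ->
  (P [set t | ((\sum_(i < n) X i t) / n%:R <= z)%R] <= (tilted_bound mu z)%:E)%E.
Proof.
move=> mul z0; apply: (le_trans (gen_poisson_lower_tail _ _ mul z0)).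
by apply: tilted_bound_mule_le => //; case/andP: mul.
Qed.

Lemma gen_poisson_upper_tail_le mu z : lam <= mu -> 0 < z ->
  (P [set t | (z <= (\sum_(i < n) X i t) / n%:R)%R] <= (tilted_bound mu z)%:E)%E.
Proof.
move=> ml z0; apply: (le_trans (gen_poisson_upper_tail _ _ ml z0)).
by apply: tilted_bound_mule_le => //; exact: lt_le_trans ml.
Qed.

End tail_bounds.
Arguments tilted_bound {R} n lam a mu z.

(* The choice [mu = nu z] minimises [tilted_bound] over [mu]. *)
Section nu.
Context {R : realType}.
Variables (n : nat) (lam a z : R).
Hypotheses (lam0 : 0 < lam) (a01 : 0 <= a < 1) (n0 : (0 < n)%N) (z0 : 0 < z).

Let nu := ((1 - a) * z
        + Num.sqrt ((1 - a) ^+ 2 * z ^+ 2 + 4 * z * a / n%:R)) / 2.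
Let z2 := lam / (1 - a + a / (n%:R * lam)).

Let b0 : 0 <= z * a / n%:R.
Proof. by case/andP: a01 => a0 a1; rewrite divr_ge0// mulr_ge0// ltW. Qed.

(** This quadratic is the critical point equation of [ln (tilted_bound n lam a mu z)] in [mu],
    cleared of denominators. *)
Lemma nu_root : nu ^+ 2 = (1 - a) * z * nu + z * a / n%:R.
Proof.
have : Num.sqrt ((1 - a) ^+ 2 * z ^+ 2 + 4 * z * a / n%:R) ^+ 2 =
   (1 - a) ^+ 2 * z ^+ 2 + 4 * (z * a / n%:R).
  rewrite sqr_sqrtr; first by rewrite !mulrA.
  apply: addr_ge0; first by apply: mulr_ge0; exact: sqr_ge0.
  by rewrite -!mulrA (mulrA z) mulr_ge0.
rewrite /nu; move: (Num.sqrt _) (z * a / n%:R) => r b; nra.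
Qed.

Lemma nu_gt0 : 0 < nu.
Proof.
case/andP: a01 => a0 a1; rewrite /nu divr_gt0// ltr_pwDl// ?sqrtr_ge0//.
by rewrite mulr_gt0// subr_gt0.
Qed.

(** Evaluate the quadratic with root [nu] at [lam]. With [c = (1 - a) z] and [D] the denominator of
    [z2], it equals both [(lam - nu) (lam + nu - c)] and [D lam (z2 - z)]; moreover [c <= nu]. *)
Let nu_sub : exists2 k, 0 < k & lam - nu = k * (z2 - z).
Proof.
have := nu_root; have := nu_gt0; case/andP: a01 => a0 a1.
have nR : 0 < n%:R :> R by rewrite ltr0n.
have D0 : 0 < 1 - a + a / (n%:R * lam).
  by rewrite ltr_pwDl ?subr_gt0// divr_ge0// mulr_ge0// ltW.
have zE : z * (1 - a + a / (n%:R * lam)) * lam = (1 - a) * z * lam + z * a / n%:R.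
  by field; rewrite !gt_eqF.
have z2E : z2 * (1 - a + a / (n%:R * lam)) = lam by rewrite divfK// gt_eqF.
have c0 : 0 < (1 - a) * z by rewrite mulr_gt0// subr_gt0.
move: (1 - a + a / _) z2E zE D0 => D z2E zE D0.
move: nu (z * a / n%:R) b0 ((1 - a) * z) c0 zE => v b b1 c c0 zE v0 vE.
have cv : c <= v.
  by rewrite -subr_ge0 -(pmulr_rge0 _ v0); have -> : v * (v - c) = b by nra.
have p0 : 0 < lam + v - c by move: lam0; lra.
exists (D * lam / (lam + v - c)); first by rewrite divr_gt0 ?mulr_gt0.
apply: (mulIf (lt0r_neq0 p0)).
rewrite mulrAC divfK ?lt0r_neq0//; nra.
Qed.

Lemma nu_le : (nu <= lam) = (z <= z2).
Proof. by have [k k0 E] := nu_sub; rewrite -subr_ge0 E pmulr_rge0// subr_ge0. Qed.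

Lemma nu_ge : (lam <= nu) = (z2 <= z).
Proof. by have [k k0 E] := nu_sub; rewrite -subr_le0 E pmulr_rle0// subr_le0. Qed.

End nu.

(** * The Poisson case *)

(** The density is even, so the half line from [0] carries half of the mass, and removing its
    endpoint changes nothing. *)
Lemma Phi0 (R : realType) : Phi (0 : R) = 1 / 2.
Proof.
have pdfN x : normal_pdf 0 1 (- x) = normal_pdf 0 1 x :> R.
  by rewrite !normal_pdfE ?oner_neq0// /normal_fun !subr0 sqrrN.
have half : (2%:E * normal_prob (0 : R) 1 `[0%R, +oo[%classic = 1)%E.
  rewrite -[RHS](@integral_normal_pdf R 0 1) ge0_symfun_integralT.
  - by rewrite set_itvE.
  - by move=> x; exact: normal_pdf_ge0.
  - by apply: continuous_normal_pdf; exact: oner_neq0.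
  - by move=> x /=; rewrite pdfN.
have E : normal_prob (0 : R) 1 `]0%R, +oo[%classic =
    normal_prob (0 : R) 1 `[0%R, +oo[%classic.
  apply: integral_itv_obnd_cbnd; apply/measurable_EFinP/measurable_funTS.
  exact: measurable_normal_pdf.
rewrite /Phi -[X in normal_prob _ _ X]setCK setCitvl.
rewrite [normal_prob _ _ _]probability_setC// [X in (1 - X)%E]E.
have : normal_prob (0 : R) 1 `[0%R, +oo[%classic \is a fin_num.
  exact: fin_num_measure.
case: (normal_prob _ _ _) half => [r /eqP|//|//].
by rewrite -EFinM eqe => /eqP h _ /=; lra.
Qed.

(** Berry-Esseen is to be applied to variables with parameter [z], not to the given [X], so a space
    carrying them is built by iterated products. *)
Lemma iid_coordinates (R : realType) (d0 : measure_display)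
    (T0 : measurableType d0) (P0 : probability T0 R) (n : nat) :
  exists (d : measure_display) (T : measurableType d) (P : probability T R)
    (p : 'I_n -> T -> T0),
    (forall i, measurable_fun setT (p i)) /\
    forall B, (forall i, measurable (B i)) ->
      P [set t | forall i, B i (p i t)] = (\prod_(i < n) P0 (B i))%E.
Proof.
elim: n => [|n [d [T [P [p [mp pE]]]]]].
  (* With no coordinates any probability space serves. *)
  exists d0, T0, P0, (fun _ t => t); split => // B _.
  rewrite big_ord0 -(probability_setT P0); congr (P0 _).
  by apply/seteqP; split => // t _ [].
exists _, (T * T0)%type, (P \x P0)%E.
exists (fun i t => if unlift ord0 i is Some j then p j t.1 else t.2).
split.
  move=> i; case: (unlift ord0 i) => [j|]; last exact: measurable_snd.
  exact: measurableT_comp (mp j) measurable_fst.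
move=> B mB; rewrite big_ord_recl muleC -(pE (fun i => B (lift ord0 i)))//.
set A := (X in (P X * _)%E).
have mA : measurable A.
  rewrite (_ : A = \bigcap_(i in [set: 'I_n]) p i @^-1` B (lift ord0 i)).
    apply: fin_bigcap_measurable => // i _.
    by rewrite -[X in measurable X]setTI; exact: mp.
  by apply/seteqP; split => t /= h i; [move=> _|]; exact: h.
rewrite -product_measure1E//; congr ((P \x P0)%E _).
apply/seteqP; split => -[t u] /= h.
  split => /= [i|]; first by have := h (lift ord0 i); rewrite liftK.
  by have := h ord0; rewrite unlift_none.
by move=> i; case: unliftP => [j ->|->]; [exact: h.1|exact: h.2].
Qed.

(** * Central moments of the Poisson law *)

Section poisson_moments.
Context {R : realType}.
Variable z : R.
Hypothesis z0 : 0 < z.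
Implicit Types (f g : nat -> R) (l m : R).

(** Expectation as a limit of partial sums, so that signed [f] are handled by limit arithmetic
    alone. *)
Definition poisson_mean f l :=
  \sum_(k < N) f k * gen_poisson_mass z 0 k @[N --> \oo] --> l.

Lemma poisson_massE k : gen_poisson_mass z 0 k = poisson_pmf z k.
Proof.
rewrite /gen_poisson_mass /poisson_pmf z0 mulr0 subr0 mulrAC; congr (_ * _ * _).
by case: k => [|k]; rewrite ?hornerC// horner_abel_polyS mulr0 addr0 exprS.
Qed.

Lemma poisson_massS k :
  k.+1%:R * gen_poisson_mass z 0 k.+1 = z * gen_poisson_mass z 0 k.
Proof.
rewrite !poisson_massE /poisson_pmf z0 factS natrM invfM exprS.
have : k.+1%:R != 0 :> R by rewrite pnatr_eq0.
by move: (k.+1%:R) => c c0; rewrite !mulrA; field; rewrite c0 pnatr_eq0 -lt0n fact_gt0.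
Qed.

Lemma poisson_mean_eq {f g l m} : (forall k, f k = g k) -> l = m ->
  poisson_mean f l -> poisson_mean g m.
Proof. by move=> /funext -> ->. Qed.

Lemma poisson_mean1 : poisson_mean (fun=> 1) 1.
Proof.
rewrite /poisson_mean; under eq_fun do under eq_bigr do rewrite mul1r.
by apply: cvg_sum_gen_poisson_mass; rewrite ?lexx ?ltr01// ltW.
Qed.

Lemma poisson_meanD {f g l m} : poisson_mean f l -> poisson_mean g m ->
  poisson_mean (fun k => f k + g k) (l + m).
Proof.
move=> fl gm; rewrite /poisson_mean.
under eq_fun do (under eq_bigr do rewrite mulrDl; rewrite big_split /=).
exact: cvgD.
Qed.

Lemma poisson_meanZ c {f l} : poisson_mean f l ->
  poisson_mean (fun k => c * f k) (c * l).
Proof.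
move=> fl; rewrite /poisson_mean.
under eq_fun do (under eq_bigr do rewrite -mulrA; rewrite -mulr_sumr).
by apply: cvgM => //; exact: cvg_cst.
Qed.

(** The Stein-Chen identity: the term [k = 0] vanishes and [k p_k = z p_(k-1)] shifts the others. *)
Lemma poisson_mean_shift {f l} : poisson_mean (fun k => f k.+1) l ->
  poisson_mean (fun k => k%:R * f k) (z * l).
Proof.
move=> fl; rewrite /poisson_mean -cvg_shiftS /=.
rewrite [X in X @ _](_ : _ =
    fun N => z * \sum_(k < N) f k.+1 * gen_poisson_mass z 0 k).
  by apply: cvgM => //; exact: cvg_cst.
apply/funext => N; rewrite big_ord_recl !mul0r add0r mulr_sumr.
by apply: eq_bigr => k _; rewrite mulrAC poisson_massS; ring.
Qed.

(** Recursion for central moments: for [f] a power of [k - z], the shifted [f] expands into powers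
    whose means are already known. *)
Lemma poisson_mean_stein {f l m} :
  poisson_mean f l -> poisson_mean (fun k => f k.+1) m ->
  poisson_mean (fun k => (k%:R - z) * f k) (z * (m - l)).
Proof.
move=> fl fm; apply: (poisson_mean_eq _ _ (poisson_meanD
  (poisson_mean_shift fm) (poisson_meanZ (- z) fl))) => [k|]; ring.
Qed.

Lemma poisson_mean_center1 : poisson_mean (fun k => k%:R - z) 0.
Proof.
apply: (poisson_mean_eq _ _ (poisson_mean_stein poisson_mean1 poisson_mean1)) => [k|];
  ring.
Qed.

Lemma poisson_mean_center2 : poisson_mean (fun k => (k%:R - z) ^+ 2) z.
Proof.
have m1 := poisson_mean_center1.
have : poisson_mean (fun k => k.+1%:R - z) 1.
  apply: (poisson_mean_eq _ _ (poisson_meanD m1 poisson_mean1)) => [k|]; last by ring.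
  by rewrite -natr1; ring.
by move=> /(poisson_mean_stein m1); apply: poisson_mean_eq => [k|]; ring.
Qed.

Lemma poisson_mean_center3 : poisson_mean (fun k => (k%:R - z) ^+ 3) z.
Proof.
have m1 := poisson_mean_center1; have m2 := poisson_mean_center2.
have : poisson_mean (fun k => (k.+1%:R - z) ^+ 2) (z + 1).
  apply: (poisson_mean_eq _ _ (poisson_meanD m2 (poisson_meanD (poisson_meanZ 2 m1)
    poisson_mean1))) => [k|]; last by ring.
  by rewrite -natr1; ring.
by move=> /(poisson_mean_stein m2); apply: poisson_mean_eq => [k|]; ring.
Qed.

Lemma poisson_mean_center4 :
  poisson_mean (fun k => (k%:R - z) ^+ 4) (3 * z ^+ 2 + z).
Proof.
have m1 := poisson_mean_center1; have m2 := poisson_mean_center2.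
have m3 := poisson_mean_center3.
have : poisson_mean (fun k => (k.+1%:R - z) ^+ 3) (z + 3 * z + 1).
  apply: (poisson_mean_eq _ _ (poisson_meanD m3 (poisson_meanD (poisson_meanZ 3 m2)
    (poisson_meanD (poisson_meanZ 3 m1) poisson_mean1)))) => [k|]; last by ring.
  by rewrite -natr1; ring.
by move=> /(poisson_mean_stein m3); apply: poisson_mean_eq => [k|]; ring.
Qed.

Lemma poisson_prob1 k :
  poisson_prob z 0%N [set k] = (gen_poisson_mass z 0 k)%:E.
Proof.
by rewrite /poisson_prob z0 esum_set1 ?poisson_massE// lee_fin poisson_pmf_ge0.
Qed.

Lemma integral_poisson f l : (forall k, 0 <= f k) -> poisson_mean f l ->
  (\int[poisson_prob z 0%N]_k (f k)%:E = l%:E)%E.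
Proof.
move=> f0 fl.
have -> : [set: nat] = \bigcup_k [set k].
  by apply/seteqP; split => // k _; exists k.
rewrite ge0_integral_bigcup//=; last 2 first.
- by move=> k _; rewrite lee_fin.
- by apply/trivIsetP => i j _ _ /eqP ij; apply/seteqP; split => // k /= [-> /ij].
apply/cvg_lim => //.
rewrite [X in X @ _](_ : _ =
  EFin \o (fun N => \sum_(k < N) f k * gen_poisson_mass z 0 k)).
  by apply: cvg_EFin => //; exact: nearW.
apply/funext => N /=; rewrite -sumEFin big_mkord; apply: eq_bigr => k _.
rewrite (eq_integral (cst (f k)%:E)); last by move=> x; rewrite inE => ->.
by rewrite integral_cst//= poisson_prob1 EFinM.
Qed.

End poisson_moments.

(** * Berry-Esseen for independent Poisson variables *)

Section poisson_berry_esseen.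
Context {R : realType} {d : measure_display} {T : measurableType d}.
Context {P : probability T R} {m : nat} {p : 'I_m.+1 -> T -> nat} {z : R}.
Hypothesis z0 : 0 < z.
Hypothesis mp : forall i, measurable_fun setT (p i).
Hypothesis pE : forall B, (forall i, measurable (B i)) ->
  P [set t | forall i, B i (p i t)] =
  (\prod_(i < m.+1) poisson_prob z 0%N (B i))%E.

Let measurable_nat_comp (g : nat -> R) i : measurable_fun setT (g \o p i).
Proof. exact: measurableT_comp (mp i). Qed.

Let Y (g : nat -> R) i : {RV P >-> R} :=
  mfun_Sub (mem_set (measurable_nat_comp g i)).

Let coord_law i B : P (p i @^-1` B) = poisson_prob z 0%N B.
Proof.
pose B' j := if j == i then B else setT.
have := pE B'; rewrite (bigD1 i)//= big1 => [|j /negPf ij]; last first.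
  by rewrite /B' ij probability_setT.
have -> : poisson_prob z 0%N B = poisson_prob z 0%N (B' i) by rewrite /B' eqxx.
rewrite mule1 => <-//; congr (P _); apply/seteqP; split => t /=.
  by move=> Bt j; rewrite /B'; case: eqP => // ->.
by move=> /(_ i); rewrite /B' eqxx.
Qed.

Let Y_law g i A : P (Y g i @^-1` A) = poisson_prob z 0%N (g @^-1` A).
Proof. by rewrite -(coord_law i). Qed.

Let Y_indep g : mutually_independent (Y g).
Proof.
move=> B mB; under [RHS]eq_bigr do rewrite Y_law.
by rewrite -(pE (fun i => g @^-1` B i)).
Qed.

Let Y_ident g : identically_distributed (Y g).
Proof. by move=> i j B mB; rewrite !Y_law. Qed.

Let integral_coord i (f : nat -> R) l : (forall k, 0 <= f k) ->
  poisson_mean z f l -> (\int[P]_t (f (p i t))%:E = l%:E)%E.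
Proof.
move=> f0 fl; rewrite -(integral_poisson z z0 f l f0 fl).
rewrite (eq_measure_integral (pushforward P (p i))) => [|A _ _].
  by rewrite ge0_integral_pushforward// => k _; rewrite lee_fin.
by rewrite /= /pushforward coord_law.
Qed.

(** The sign [e = 1] or [e = -1] lets one estimate at [0] serve both tails. *)
Let g e k : R := (k%:R - z) * e.

Let moment_mean i e : ('E_P[Y (g e) i] = 0)%E.
Proof.
have z_ge0 := ltW z0.
(* The centered variable is signed, so the nonnegative uncentered one is integrated first and [z] is
   subtracted by linearity. *)
pose Q t : R := (p i t)%:R.
have EQ : (\int[P]_t (Q t)%:E = z%:E)%E.
  apply: (integral_coord i (fun k => k%:R)) => //.
  have := poisson_meanD z (poisson_mean_center1 z z0)
    (poisson_meanZ z z (poisson_mean1 z z0)).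
  by apply: poisson_mean_eq => [k|]; ring.
have iQ : P.-integrable setT (EFin \o Q).
  apply/integrableP; split; first exact/measurable_EFinP/measurable_nat_comp.
  under eq_integral do rewrite /= ger0_norm//.
  by rewrite EQ ltry.
have iz : P.-integrable setT (EFin \o cst z).
  exact: finite_measure_integrable_cst.
have LQ : Q \in Lfun P 1 by exact/Lfun1_integrable.
have Lz : (cst z : T -> R) \in Lfun P 1 by exact/Lfun1_integrable.
have -> : Y (g e) i = e \o* (Q \- cst z) :> (T -> R) by [].
rewrite expectationZl; last exact: rpredB.
by rewrite expectationB// expectation_cst unlock EQ subee// mule0.
Qed.

Let moment_sqr i e : e ^+ 2 = 1 -> ('E_P[(fun t => Y (g e) i t ^+ 2)%R] = z%:E)%E.
Proof.
move=> e2; rewrite unlock.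
apply: (integral_coord i (fun k => g e k ^+ 2)) => [k|]; first exact: sqr_ge0.
apply: (poisson_mean_eq z _ _ (poisson_mean_center2 z z0)) => // k.
by rewrite /g exprMn e2 mulr1.
Qed.

(* Weighted AM-GM in the form [4 v^3 w <= 3 v^4 + w^4], with [w] the fourth
   root of the fourth moment. *)
Let moment_cube i e : e ^+ 2 = 1 ->
  ('E_P[(fun t => `|Y (g e) i t| ^+ 3)%R] <=
   ((3 * z ^+ 2 + z) `^ (3 / 4))%:E)%E.
Proof.
move=> e2; set M := 3 * z ^+ 2 + z.
have M0 : 0 < M by rewrite ltr_wpDl// mulr_ge0// sqr_ge0.
pose w := M `^ (1 / 4).
have w0 : 0 < w by exact: powR_gt0.
have w4 : w ^+ 4 = M.
  rewrite /w -powR_mulrn ?powR_ge0// -powRrM.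
  by rewrite (_ : 1 / 4 * 4%:R = 1) ?powRr1 ?ltW//; lra.
have w3 : M `^ (3 / 4) = w ^+ 3.
  rewrite /w -powR_mulrn ?powR_ge0// -powRrM; congr (_ `^ _); lra.
(* The AM-GM majorant of the cube, divided by [4 w]; its mean is [w^3] because the fourth moment is
   [w^4]. *)
pose f (k : nat) : R := (3 / (4 * w)) * (k%:R - z) ^+ 4 + w ^+ 3 / 4 * 1.
have f0 k : 0 <= f k.
  apply: addr_ge0; apply: mulr_ge0 => //; rewrite ?exprn_even_ge0 ?divr_ge0//.
    by rewrite mulr_ge0// ltW.
  by rewrite exprn_ge0// ltW.
have fE : poisson_mean z f (w ^+ 3).
  apply: (poisson_mean_eq z _ _ (poisson_meanD z
    (poisson_meanZ z _ (poisson_mean_center4 z z0))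
    (poisson_meanZ z _ (poisson_mean1 z z0)))) => //.
  by rewrite -/M -w4; field; rewrite gt_eqF.
rewrite w3 -(integral_coord i f _ f0 fE) unlock.
apply: ge0_le_integral => //.
- apply/measurable_EFinP; exact: (measurable_nat_comp (fun k => `|g e k| ^+ 3)).
- apply/measurable_EFinP; exact: (measurable_nat_comp f).
move=> t _; rewrite lee_fin /=.
have : `|Y (g e) i t| = `|(p i t)%:R - z|.
  have : `|e| = 1 by apply/eqP; rewrite -(@eqrXn2 _ 2)// expr1n -normrX e2 normr1.
  by move=> e1; rewrite /= /g normrM e1 mulr1.
move=> ->; rewrite /f; set u := (p i t)%:R - z.
have -> : u ^+ 4 = `|u| ^+ 4 by rewrite -normrX ger0_norm// exprn_even_ge0.
move: `|u| (normr_ge0 u) => v v0.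
have -> : 3 / (4 * w) * v ^+ 4 + w ^+ 3 / 4 * 1 = (3 * v ^+ 4 + w ^+ 4) / (4 * w).
  by field; rewrite gt_eqF.
rewrite ler_pdivlMr ?mulr_gt0// -subr_ge0.
have -> : 3 * v ^+ 4 + w ^+ 4 - v ^+ 3 * (4 * w) =
  (v - w) ^+ 2 * (3 * v ^+ 2 + 2 * v * w + w ^+ 2) by ring.
by rewrite mulr_ge0 ?sqr_ge0// !addr_ge0 ?mulr_ge0 ?sqr_ge0// ltW.
Qed.

Let lyapunov_ratio :
  (3 * z ^+ 2 + z) `^ (3 / 4) / z `^ (3 / 2) = (3 + 1 / z) `^ (3 / 4).
Proof.
have -> : 3 * z ^+ 2 + z = z `^ 2 * (3 + 1 / z).
  by rewrite powR_mulrn ?ltW//; field; rewrite gt_eqF.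
rewrite powRM ?powR_ge0// ?addr_ge0 ?divr_ge0 ?ltW// -powRrM.
have -> : 2 * (3 / 4) = 3 / 2 :> R by lra.
by rewrite mulrAC mulfV ?mul1r// gt_eqF ?powR_gt0.
Qed.

Variable C : R.
Hypothesis beC : berry_esseen_constant C.

(** Berry-Esseen at [y = 0], where [Phi] is one half and the positive normalisation does not affect
    the event. *)
Let signed_tail e : e ^+ 2 = 1 ->
  (P [set t | ((\sum_(i < m.+1) (p i t)%:R - m.+1%:R * z) * e <= 0)%R] <=
   (1 / 2 + C / Num.sqrt m.+1%:R * (3 + 1 / z) `^ (3 / 4))%:E)%E.
Proof.
move=> e2; have [C0 be] := beC.
have mR : 0 < m.+1%:R :> R by rewrite ltr0n.
have := be d T P m (Y (g e)) (Y_indep _) (Y_ident _) (moment_mean _ _).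
have E3 := moment_cube ord0 e e2.
rewrite moment_sqr// lte_fin z0 (le_lt_trans E3) ?ltry// => /(_ isT isT 0).
rewrite Phi0 [fine z%:E]/=.
set A' := [set t | (\sum_(i < m.+1) (p i t)%:R - m.+1%:R * z) * e <= 0].
have YE t : (\sum_(i < m.+1) (p i t)%:R - m.+1%:R * z) * e =
    \sum_(i < m.+1) Y (g e) i t.
  transitivity (\sum_(i < m.+1) ((p i t)%:R - z) * e) => //.
  by rewrite -mulr_suml sumrB sumr_const card_ord mulr_natl.
have A'E : A' = [set t | \sum_(i < m.+1) Y (g e) i t <= 0].
  by apply/seteqP; split => t; rewrite /A' /= YE.
have mA' : measurable A'.
  rewrite A'E -[X in measurable X]setTI.
  have mS : measurable_fun setT (fun t => \sum_(i < m.+1) Y (g e) i t).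
    exact: measurable_sum.
  by have := mS measurableT [set x | x <= 0]; apply; rewrite -set_itvE.
set A := (X in P X) => h.
have AE : A = A'.
  rewrite A'E; apply/seteqP; split => t; rewrite /A /=;
    by rewrite pmulr_lle0 ?invr_gt0 ?sqrtr_gt0 ?mulr_gt0.
rewrite {}AE in h.
rewrite -[P A']fineK ?fin_num_measure// lee_fin.
have /ler_normlW := h; rewrite lerBlDl => /le_trans; apply.
rewrite lerD2l -lyapunov_ratio mulrA; apply: ler_wpM2r.
  by rewrite invr_ge0 powR_ge0.
apply: ler_wpM2l; first by rewrite divr_ge0 ?sqrtr_ge0// ltW.
rewrite -lee_fin fineK// ge0_fin_numE ?(le_lt_trans E3) ?ltry//.
by apply: expectation_ge0 => t; rewrite exprn_ge0.
Qed.

Let mass_coord i k : P (Y (fun k => k%:R) i @^-1` [set k%:R]) =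
  (gen_poisson_mass z 0 k)%:E.
Proof.
rewrite Y_law -(poisson_prob1 z z0); congr (poisson_prob _ _ _).
by apply/seteqP; split => j /= => [/eqP|->//]; rewrite eqr_nat => /eqP.
Qed.

(** The law of the sum, read from right to left, turns the series into the probability that the
    coordinates sum to at most their mean. *)
Lemma poisson_lower_half :
  (\sum_(0 <= s <oo | (s%:R <= m.+1%:R * z)%R)
     (gen_poisson_mass (m.+1%:R * z) 0 s)%:E <=
   (1 / 2 + C / Num.sqrt m.+1%:R * (3 + 1 / z) `^ (3 / 4))%:E)%E.
Proof.
rewrite -(gen_poisson_sum_law (ltW z0) _ (Y_indep _) mass_coord
  (fun x => x <= m.+1%:R * z)) ?lexx ?ltr01 -?set_itvE//.
have := signed_tail 1 (expr1n _ _).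
by under eq_set do rewrite mulr1 subr_le0.
Qed.

Lemma poisson_upper_half :
  (\sum_(0 <= s <oo | (m.+1%:R * z <= s%:R)%R)
     (gen_poisson_mass (m.+1%:R * z) 0 s)%:E <=
   (1 / 2 + C / Num.sqrt m.+1%:R * (3 + 1 / z) `^ (3 / 4))%:E)%E.
Proof.
rewrite -(gen_poisson_sum_law (ltW z0) _ (Y_indep _) mass_coord
  (fun x => m.+1%:R * z <= x)) ?lexx ?ltr01 -?set_itvE//.
have e2 : (- 1) ^+ 2 = 1 :> R by rewrite sqrrN expr1n.
have := signed_tail (- 1) e2.
by under eq_set do rewrite mulrN1 oppr_le0 subr_ge0.
Qed.

End poisson_berry_esseen.

Lemma poisson_half_bounds {R : realType} (C z : R) (n : nat) :
  berry_esseen_constant C -> 0 < z -> (0 < n)%N ->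
  let b := (1 / 2 + Num.min (1 / 2)
    (C / Num.sqrt n%:R * (3 + 1 / z) `^ (3 / 4)))%:E in
  (\sum_(0 <= s <oo | (s%:R <= n%:R * z)%R)
     (gen_poisson_mass (n%:R * z) 0 s)%:E <= b)%E /\
  (\sum_(0 <= s <oo | (n%:R * z <= s%:R)%R)
     (gen_poisson_mass (n%:R * z) 0 s)%:E <= b)%E.
Proof.
case: n => // m beC z0 _ b.
have [d [T [P [p [mp pE]]]]] := iid_coordinates R _ _ (poisson_prob z 0%N) m.+1.
(* The total mass bounds every partial series by [1], which settles the case where the minimum is
   [1 / 2]. *)
have le1 (c : pred nat) : (\sum_(0 <= s <oo | c s)
    (gen_poisson_mass (m.+1%:R * z) 0 s)%:E <= (1 / 2 + 1 / 2 : R)%:E)%E.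
  have mz0 : 0 <= m.+1%:R * z by rewrite mulr_ge0// ltW.
  have -> : 1 / 2 + 1 / 2 = 1 :> R by lra.
  rewrite -[leRHS](nneseries_gen_poisson_mass (m.+1%:R * z) 0) ?lexx ?ltr01//.
  by apply: subset_lee_nneseries => // s _; rewrite lee_fin gen_poisson_mass_ge0.
rewrite /b /Num.min; case: ifP => _; first by split; exact: le1.
by split; [exact: (poisson_lower_half z0 mp pE _ beC)|
  exact: (poisson_upper_half z0 mp pE _ beC)].
Qed.

(** * Specialisation to [mu = (1 - a) z], [mu = nu z] and, for [a = 0], [mu = z] *)

Theorem theorem8 (R : realType) (d : measure_display) (T : measurableType d)
    (P : probability T R) (n : nat) (X : 'I_n -> {RV P >-> R})
    (lam a : R) :
  0 < lam -> 0 <= a < 1 -> (0 < n)%N ->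
  mutually_independent X ->
  (forall i (k : nat), P (X i @^-1` [set k%:R]) = (gen_poisson_pmf lam a k)%:E) ->
  let Xbar := fun t => (\sum_(i < n) X i t) / n%:R in
  let B1 := fun z : R => lam / ((1 - a) * (lam + z * a)) *
        ((lam / z + a) `^ z * expR ((1 - a) * z) / expR lam) ^+ n in
  let nu := fun z : R => (((1 - a) * z
        + Num.sqrt ((1 - a) ^+ 2 * z ^+ 2 + 4 * z * a / n%:R)) / 2) in
  let B2 := fun z : R => lam * (nu z + z * a) / (nu z * (lam + z * a)) *
        (((lam + z * a) / (nu z + z * a)) `^ z * expR (nu z) / expR lam) ^+ n in
  let z2 := lam / (1 - a + a / (n%:R * lam)) in
  (forall z : R, 0 < z <= lam / (1 - a) ->
     (P [set t | (Xbar t <= z)%R] <= (B1 z)%:E)%E) /\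
  (forall z : R, lam / (1 - a) <= z ->
     (P [set t | (z <= Xbar t)%R] <= (B1 z)%:E)%E) /\
  (forall z : R, 0 < z <= z2 ->
     (P [set t | (Xbar t <= z)%R] <= (B2 z)%:E)%E) /\
  (forall z : R, z2 <= z ->
     (P [set t | (z <= Xbar t)%R] <= (B2 z)%:E)%E) /\
  (a = 0 -> forall C : R, berry_esseen_constant C ->
     let Delta := fun z : R =>
       Num.min (1 / 2) (C / Num.sqrt n%:R * (3 + 1 / z) `^ (3 / 4)) in
     let B3 := fun z : R => (1 / 2 + Delta z) *
       (lam `^ z * expR z / (z `^ z * expR lam)) ^+ n in
     (forall z : R, lam <= z -> (P [set t | (z <= Xbar t)%R] <= (B3 z)%:E)%E) /\
     (forall z : R, 0 < z <= lam -> (P [set t | (Xbar t <= z)%R] <= (B3 z)%:E)%E)).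
Proof.
move=> lam0 a01 n0 indepX pmfX Xbar B1 nu B2 z2.
have /andP[a0 a1] := a01.
have nR : 0 < n%:R :> R by rewrite ltr0n.
have ca0 : 0 < 1 - a by rewrite subr_gt0.
have massX i k : P (X i @^-1` [set k%:R]) = (gen_poisson_mass lam a k)%:E.
  by rewrite pmfX gen_poisson_massE.
have z20 : 0 < z2.
  rewrite divr_gt0// ltr_pwDl// divr_ge0// mulr_ge0// ltW//.
have B1E z : 0 < z -> B1 z = tilted_bound n lam a ((1 - a) * z) z.
  move=> z0; rewrite /B1 /tilted_bound.
  (* For this [mu] the mean [mu / (1 - a)] is exactly [z], which gives the bound its simple form. *)
  have -> : (1 - a) * z + z * a = z by ring.
  have za : 0 < lam + z * a by rewrite ltr_pwDl// mulr_ge0// ltW.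
  congr (_ * (_ `^ _ * _ / _) ^+ _); first by field; rewrite !gt_eqF.
  by field; rewrite gt_eqF.
have B2E z : B2 z = tilted_bound n lam a (nu z) z by [].
split; [|split; [|split; [|split]]].
- move=> z /andP[z0 zl]; rewrite B1E//.
  apply: gen_poisson_lower_tail_le => //.
  by rewrite mulr_gt0//= mulrC -ler_pdivlMr.
- move=> z zl; have z0 : 0 < z by apply: lt_le_trans zl; rewrite divr_gt0.
  rewrite B1E//; apply: gen_poisson_upper_tail_le => //.
  by rewrite mulrC -ler_pdivrMr.
- move=> z /andP[z0 zl]; rewrite B2E; apply: gen_poisson_lower_tail_le => //.
  by rewrite nu_gt0//= nu_le.
- move=> z zl; have z0 : 0 < z by exact: lt_le_trans zl.
  rewrite B2E; apply: gen_poisson_upper_tail_le => //.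
  by rewrite nu_ge.
move=> a_eq0 C beC Delta B3.
(* For [a = 0] and [mu = z] the prefactor of the bound is [1]. *)
have B3E z : 0 < z -> B3 z = (1 / 2 + Delta z) * tilted_bound n lam a z z.
  move=> z0; rewrite /B3 /tilted_bound a_eq0 !mulr0 !addr0.
  rewrite (_ : lam * z / (z * lam) = 1) ?mul1r; last first.
    by field; rewrite !gt_eqF.
  congr (_ * _ ^+ _); rewrite /powR !gt_eqF ?divr_gt0// ln_div ?posrE// mulrBr.
  by rewrite [in RHS]expRD [in RHS]expRN; field; rewrite !gt_eqF ?expR_gt0.
have halves z : 0 < z -> (\sum_(0 <= s <oo | (s%:R <= n%:R * z)%R)
     (gen_poisson_mass (n%:R * z) a s)%:E <= (1 / 2 + Delta z)%:E)%E /\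
  (\sum_(0 <= s <oo | (n%:R * z <= s%:R)%R)
     (gen_poisson_mass (n%:R * z) a s)%:E <= (1 / 2 + Delta z)%:E)%E.
  by move=> z0; rewrite a_eq0; exact: poisson_half_bounds.
split => [z lz|z /andP[z0 zl]].
  have z0 : 0 < z by exact: lt_le_trans lz.
  rewrite B3E// mulrC EFinM.
  apply: (le_trans (gen_poisson_upper_tail lam0 a01 n0 indepX massX _ _ lz z0)).
  apply: lee_wpmul2l; first by rewrite lee_fin tilted_bound_ge0.
  exact: (halves z z0).2.
have z0l : 0 < z <= lam by rewrite z0.
rewrite B3E// mulrC EFinM.
apply: (le_trans (gen_poisson_lower_tail lam0 a01 n0 indepX massX _ _ z0l z0)).
apply: lee_wpmul2l; first by rewrite lee_fin tilted_bound_ge0.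
exact: (halves z z0).1.
Qed.
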